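(* Let $X$ be a real tree such that every geodesic of $X$ can be extended, and let $p\in X$ be a point at which the valency of $X$ is finite. If $X$ is an asymptotic cone (that is, $X$ is isometric to $C(Y,q,\nu)$ for some metric space $Y$, some $q\in{}^*Y$ and some $\nu\in{}^*\mathbb{R}$ with $\nu\gg1$), then $p$ is isolated from the other branching points, i.e. there exists $\epsilon>0$ such that no branching point $x\neq p$ of $X$ satisfies $d(x,p)<\epsilon$.
   Context: Nonstandard extensions. Fix a non-principal ultrafilter $\mathcal{U}$ on $\mathbb{N}$. For a set $X$, ${}^*X$ is the ultrapower $X^{\mathbb{N}}/\mathcal{U}$ (functions identified if they agree on a set in $\mathcal{U}$), with $X\subseteq{}^*X$ via constant functions; functions and relations (in particular the order and operations of $\mathbb{R}$ and the metric $d$ of a metric space, giving $d:{}^*X\times{}^*X\to{}^*\mathbb{R}$) are extended componentwise modulo $\mathcal{U}$. For $\xi,\eta\in{}^*\mathbb{R}$, $\eta\neq 0$: $\xi\in o(\eta)$ means $\xi/\eta$ is infinitesimal; $\xi\in O(\eta)$ means $\xi/\eta$ is finite, i.e. bounded in absolute value by a standard real; $\xi\gg\eta$ means $\xi,\eta$ are nonnegative and $\xi/\eta$ is infinite. For finite $\xi\in{}^*\mathbb{R}$, $st(\xi)$ is the unique real with $\xi-st(\xi)$ infinitesimal. Asymptotic cones. Let $(Y,d)$ be a metric space, $q\in{}^*Y$ (basepoint) and $\nu\in{}^*\mathbb{R}$, $\nu\gg 1$ (scaling factor). On ${}^*Y$ put $x\sim y\iff d(x,y)\in o(\nu)$. The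 asymptotic cone is $C(Y,q,\nu)=\{[x]\in{}^*Y/{\sim}\,:\, d(x,q)\in O(\nu)\}$ with metric $d([x],[y])=st(d(x,y)/\nu)$. Real trees. A geodesic in a metric space $X$ is a map $\gamma:[0,l]\to X$ with $d(\gamma(t),\gamma(s))=|t-s|$ for all $t,s$; $X$ is geodesic if any two points are joined by a geodesic. A real tree is a complete geodesic metric space in which every geodesic triangle is a tripod, i.e. each side is contained in the union of the other two. ''Every geodesic can be extended'' means that every geodesic $\gamma:[0,l]\to X$ with $l>0$ is the restriction to $[0,l]$ of a geodesic $[0,l']\to X$ with $l'>l$. The valency of a real tree $T$ at $p\in T$ is the number (cardinality of the set) of connected components of $T\setminus\{p\}$. A branching point is a point of valency greater than 2. *)

(* Defs.v *)
From HB Require Import structures.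
From mathcomp Require Import all_boot all_order all_algebra generic_quotient.
From mathcomp Require Import all_classical all_reals all_analysis.
From mathcomp Require Import ring lra.

Set Implicit Arguments.
Unset Strict Implicit.
Unset Printing Implicit Defensive.

Import Order.TTheory GRing.Theory Num.Theory.
Import numFieldNormedType.Exports.

Local Open Scope classical_set_scope.
Local Open Scope ring_scope.
Local Open Scope quotient_scope.

Record nonprincipal_ultrafilter := NonprincipalUltrafilter {
  ultra_sets :> set nat -> Prop;
  ultra_setsP : UltraFilter ultra_sets;
  ultra_setsNprincipal : forall n : nat, ultra_sets <> principal_filter n
}.
#[global] Existing Instance ultra_setsP.

Section Ultrapower.
Variable U : nonprincipal_ultrafilter.

Section Carrier.
Variable X : choiceType.

Definition ultra_eq : rel (nat -> X) := fun f g => `[< U [set n | f n = g n] >].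

Lemma ultra_eq_refl : reflexive ultra_eq.
Proof. by move=> f; apply/asboolP; apply: filterS filterT. Qed.

Lemma ultra_eq_sym : symmetric ultra_eq.
Proof.
by move=> f g; apply/asbool_equiv_eq; split; apply: filterS => n /= ->.
Qed.

Lemma ultra_eq_trans : transitive ultra_eq.
Proof.
move=> g f h /asboolP fg /asboolP gh; apply/asboolP.
by apply: filterS2 fg gh => n /= -> ->.
Qed.

Canonical ultra_eq_equiv :=
  EquivRel ultra_eq ultra_eq_refl ultra_eq_sym ultra_eq_trans.

Definition star : Type := {eq_quot ultra_eq_equiv}.
HB.instance Definition _ := Choice.on star.
HB.instance Definition _ := EqQuotient.on star.

Definition star_of (x : X) : star := \pi_star (fun=> x).

Lemma star_eqP (f g : nat -> X) :
  \pi_star f = \pi_star g <-> U [set n | f n = g n].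
Proof.
split; first by move=> /eqmodP /asboolP.
by move=> h; apply/eqmodP/asboolP.
Qed.

Lemma star_repr (f : nat -> X) : U [set n | repr (\pi_star f) n = f n].
Proof. by apply/star_eqP; rewrite reprK. Qed.

End Carrier.

Definition star_map (X Z : choiceType) (f : X -> Z) (x : star X) : star Z :=
  \pi_(star Z) (fun n => f (repr x n)).

Definition star_map2 (X Y Z : choiceType) (f : X -> Y -> Z)
    (x : star X) (y : star Y) : star Z :=
  \pi_(star Z) (fun n => f (repr x n) (repr y n)).

Definition star_rel (X Y : choiceType) (r : X -> Y -> Prop)
    (x : star X) (y : star Y) : Prop :=
  U [set n | r (repr x n) (repr y n)].

Lemma star_mapE (X Z : choiceType) (f : X -> Z) (x : nat -> X) :
  star_map f (\pi_(star X) x) = \pi_(star Z) (fun n => f (x n)).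
Proof. by apply/star_eqP; apply: filterS (star_repr x) => n /= ->. Qed.

Lemma star_map2E (X Y Z : choiceType) (f : X -> Y -> Z) (x : nat -> X)
    (y : nat -> Y) :
  star_map2 f (\pi_(star X) x) (\pi_(star Y) y) =
  \pi_(star Z) (fun n => f (x n) (y n)).
Proof.
by apply/star_eqP; apply: filterS2 (star_repr x) (star_repr y) => n /= -> ->.
Qed.

Lemma star_relE (X Y : choiceType) (r : X -> Y -> Prop) (x : nat -> X)
    (y : nat -> Y) :
  star_rel r (\pi_(star X) x) (\pi_(star Y) y) <-> U [set n | r (x n) (y n)].
Proof.
rewrite /star_rel; split=> h.
  by apply: filterS3 (star_repr x) (star_repr y) h => n /= -> ->.
by apply: filterS3 (star_repr x) (star_repr y) h => n /= -> ->.
Qed.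

Section Hyperreals.
Variable R : realType.
Implicit Types (xi eta : star R) (r : R).

Definition star_le xi eta : Prop := star_rel (fun a b : R => a <= b) xi eta.
Definition star_lt xi eta : Prop := star_rel (fun a b : R => a < b) xi eta.
Definition star_abs xi : star R := star_map (fun a : R => `|a|) xi.
Definition star_sub xi eta : star R := star_map2 (fun a b : R => a - b) xi eta.
(* Since [0^-1 = 0] in [R], this is a total function; it is the quotient of
   the field [star R] when [eta] is nonzero, the only case of interest. *)
Definition star_div xi eta : star R := star_map2 (fun a b : R => a / b) xi eta.

Definition infinitesimal xi : Prop :=
  forall e : R, 0 < e -> star_lt (star_abs xi) (star_of e).

Definition star_finite xi : Prop :=
  exists M : R, star_le (star_abs xi) (star_of M).

Definition star_infinite xi : Prop := ~ star_finite xi.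

Definition in_littleo xi eta : Prop := infinitesimal (star_div xi eta).

Definition in_bigO xi eta : Prop := star_finite (star_div xi eta).

Definition much_greater xi eta : Prop :=
  [/\ star_le (star_of 0) xi, star_le (star_of 0) eta
    & star_infinite (star_div xi eta)].

(* The value is meaningful only for finite [xi]: see [st_finite] and
   [st_unique]. *)
Definition st xi : R := xget 0 [set r | infinitesimal (star_sub xi (star_of r))].

Lemma infinitesimalE (f : nat -> R) :
  infinitesimal (\pi_(star R) f) <-> forall e, 0 < e -> U [set n | `|f n| < e].
Proof.
rewrite /infinitesimal /star_lt /star_abs star_mapE.
by split=> h e /h; rewrite star_relE.
Qed.

Lemma star_finiteE (f : nat -> R) :
  star_finite (\pi_(star R) f) <-> exists M, U [set n | `|f n| <= M].
Proof.
rewrite /star_finite /star_le /star_abs star_mapE.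
by split=> -[M h]; exists M; move: h; rewrite star_relE.
Qed.

Lemma infinitesimal_finite xi : infinitesimal xi -> star_finite xi.
Proof.
rewrite -[xi]reprK infinitesimalE star_finiteE => /(_ 1 ltr01) h; exists 1.
by apply: filterS h => n /= /ltW.
Qed.

Lemma star_sub_stE (f : nat -> R) (r : R) :
  infinitesimal (star_sub (\pi_(star R) f) (star_of r)) <->
  forall e, 0 < e -> U [set n | `|f n - r| < e].
Proof. by rewrite /star_sub /star_of star_map2E infinitesimalE. Qed.

Lemma st_unique xi r : infinitesimal (star_sub xi (star_of r)) -> st xi = r.
Proof.
move=> hr; rewrite /st; case: xgetP => [s _|/(_ r)//].
move: hr; rewrite -[xi]reprK => /star_sub_stE hr /star_sub_stE hs.
apply/eqP/negPn/negP => sr.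
pose e := `|s - r| / 2.
have e0 : 0 < e by rewrite divr_gt0// normr_gt0 subr_eq0.
have [n /=] := filter_ex (filterI (hr _ e0) (hs _ e0)).
move=> [nr ns]; have := ltrD ns nr.
rewrite -splitr ltNge => /negP; apply.
by rewrite (distrC (repr xi n) s) (le_trans _ (ler_normD _ _))// addrA subrK.
Qed.

Lemma st_finite xi :
  star_finite xi -> infinitesimal (star_sub xi (star_of (st xi))).
Proof.
move=> fxi; suff [r hr] : exists r, infinitesimal (star_sub xi (star_of r)).
  by rewrite (st_unique hr).
move: fxi; rewrite -[xi]reprK => /star_finiteE[M hM].
set f := repr xi in hM *.
have [r [_ cr]] : `[- M, M]%classic `&` cluster (fmap f (ultra_sets U)) !=set0.
  apply: (@segment_compact R); rewrite /fmap /=.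
  by apply: filterS hM => n /=; rewrite in_itv/= ler_norml.
exists r; apply/star_sub_stE => e e0.
have [//|nU] := in_ultra_setVsetC [set n | `|f n - r| < e] (ultra_setsP U).
have [|s [/= sN]] := cr (~` ball r e) (ball r e) _ (nbhsx_ballx r e e0).
  by apply: filterS nU => n /=; rewrite /ball/= distrC.
by [].
Qed.

End Hyperreals.

Section Cone.
Variables (R : realType) (Y : metricType R).
Implicit Types (x y z q : star Y) (nu : star R).

Definition star_dist x y : star R := star_map2 (@mdist R Y) x y.

Definition cone_eq nu : rel (star Y) :=
  fun x y => `[< in_littleo (star_dist x y) nu >].

Lemma scaled_distE (f g : nat -> Y) (m : nat -> R) :
  star_div (star_dist (\pi_(star Y) f) (\pi_(star Y) g)) (\pi_(star R) m) =
  \pi_(star R) (fun n => mdist (f n) (g n) / m n).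
Proof. by rewrite /star_dist /star_div !star_map2E. Qed.

Lemma cone_eq_refl nu : reflexive (cone_eq nu).
Proof.
move=> x; apply/asboolP; rewrite /in_littleo -[x]reprK -[nu]reprK scaled_distE.
apply/infinitesimalE => e e0; apply: filterS filterT => n _ /=.
by rewrite mdistxx mul0r normr0.
Qed.

Lemma star_distC x y : star_dist x y = star_dist y x.
Proof.
by rewrite /star_dist /star_map2; congr (\pi _); apply/funext => n;
  rewrite metric_sym.
Qed.

Lemma cone_eq_sym nu : symmetric (cone_eq nu).
Proof. by move=> x y; rewrite /cone_eq star_distC. Qed.

Lemma cone_eq_trans nu : transitive (cone_eq nu).
Proof.
move=> y x z /asboolP; rewrite /in_littleo -[x]reprK -[y]reprK -[z]reprK.
rewrite -[nu]reprK scaled_distE => /infinitesimalE xy /asboolP.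
rewrite /in_littleo scaled_distE => /infinitesimalE yz.
apply/asboolP; rewrite /in_littleo scaled_distE.
apply/infinitesimalE => e e0; have e20 : 0 < e / 2 by rewrite divr_gt0.
apply: filterS2 (xy _ e20) (yz _ e20) => n /= xyn yzn.
rewrite [e]splitr; apply: le_lt_trans (ltrD xyn yzn).
rewrite !normrM -mulrDl ler_wpM2r// !ger0_norm ?mdist_ge0//.
exact: metric_triangle.
Qed.

Canonical cone_eq_equiv nu :=
  EquivRel (cone_eq nu) (cone_eq_refl nu) (@cone_eq_sym nu) (@cone_eq_trans nu).

Definition cone_quot nu : Type := {eq_quot (cone_eq_equiv nu)}.
HB.instance Definition _ nu := Choice.on (cone_quot nu).
HB.instance Definition _ nu := EqQuotient.on (cone_quot nu).

Definition in_cone q nu : pred (cone_quot nu) := fun c =>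
  `[< exists2 x, c = \pi_(cone_quot nu) x & in_bigO (star_dist x q) nu >].

(* The proof that [nu] is much greater than 1 is a parameter of the type
   because [cone_dist] is a metric only when [nu] is nonnegative. *)
Definition cone q nu (nu1 : much_greater nu (star_of 1)) : Type :=
  {c : cone_quot nu | in_cone q c}.
HB.instance Definition _ q nu (nu1 : much_greater nu (star_of 1)) :=
  Choice.on (cone q nu1).

Section ConeMetric.
Variables (q : star Y) (nu : star R) (nu1 : much_greater nu (star_of 1)).
Local Notation C := (cone q nu1).

(* [cone_distE] shows that the choice of representatives is irrelevant. *)
Definition cone_dist (a b : C) : R :=
  st (star_div (star_dist (repr (\val a)) (repr (\val b))) nu).

Lemma cone_scale_ge0 : U [set n | 0 <= repr nu n].
Proof.
case: nu1; rewrite -{1}[nu]reprK /star_le /star_of => /star_relE h _ _.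
exact: h.
Qed.

Let d (f g : star Y) (n : nat) : R := mdist (repr f n) (repr g n) / repr nu n.

Let distE (x y : star Y) : star_div (star_dist x y) nu = \pi_(star R) (d x y).
Proof. by rewrite -{1}[x]reprK -{1}[y]reprK -{1}[nu]reprK scaled_distE. Qed.

Let d_ge0 (x y : star Y) : U [set n | 0 <= d x y n].
Proof.
by apply: filterS cone_scale_ge0 => n /= h; rewrite divr_ge0// mdist_ge0.
Qed.

Let d_triangle (x y z : star Y) : U [set n | d x z n <= d x y n + d y z n].
Proof.
apply: filterS cone_scale_ge0 => n /= h.
by rewrite -mulrDl ler_wpM2r ?invr_ge0// metric_triangle.
Qed.

Let dC (x y : star Y) : d x y = d y x.
Proof. by apply/funext => n; rewrite /d metric_sym. Qed.

Lemma cone_repr (a : C) : in_bigO (star_dist (repr (\val a)) q) nu.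
Proof.
have /asboolP[x ax] := valP a.
have : in_littleo (star_dist (repr (\val a)) x) nu.
  have : \pi_(cone_quot nu) (repr (\val a)) = \pi_(cone_quot nu) x.
    by rewrite reprK.
  by move=> /eqmodP /asboolP.
rewrite /in_littleo /in_bigO !distE => /infinitesimalE/(_ 1 ltr01) ha.
move=> /star_finiteE[M hM]; apply/star_finiteE; exists (1 + M).
apply: filterS2 (filterI ha hM)
  (filterI (d_triangle (repr (\val a)) x q) (d_ge0 (repr (\val a)) q)).
move=> n /= [h1 h2] [h3 h4]; rewrite ger0_norm// (le_trans h3)// lerD//.
  exact: le_trans (ler_norm _) (ltW h1).
exact: le_trans (ler_norm _) h2.
Qed.

Let d_finite (x y : star Y) : in_bigO (star_dist x q) nu ->
  in_bigO (star_dist y q) nu -> star_finite (\pi_(star R) (d x y)).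
Proof.
rewrite /in_bigO !distE => /star_finiteE[M hM] /star_finiteE[N hN].
apply/star_finiteE; exists (M + N).
apply: filterS2 (filterI hM hN) (filterI (d_triangle x q y) (d_ge0 x y)).
move=> n /= [h1 h2] [h3 h4]; rewrite ger0_norm// (le_trans h3)// lerD//.
  exact: le_trans (ler_norm _) h1.
by rewrite dC; exact: le_trans (ler_norm _) h2.
Qed.

Let st_d (x y : star Y) : in_bigO (star_dist x q) nu ->
  in_bigO (star_dist y q) nu -> forall e : R, 0 < e ->
  U [set n | `|d x y n - st (\pi_(star R) (d x y))| < e].
Proof. by move=> hx hy; apply/star_sub_stE/st_finite/d_finite. Qed.

Let cone_near (a b : C) (e : R) : 0 < e ->
  U [set n | `|d (repr (\val a)) (repr (\val b)) n - cone_dist a b| < e].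
Proof.
by rewrite /cone_dist distE; apply: st_d; exact: cone_repr.
Qed.

Lemma cone_distE (a b : C) (x y : star Y) :
    \val a = \pi_(cone_quot nu) x -> \val b = \pi_(cone_quot nu) y ->
  cone_dist a b = st (star_div (star_dist x y) nu).
Proof.
move=> ax bY; apply/esym/st_unique; rewrite distE.
have : \pi_(cone_quot nu) (repr (\val a)) = \pi_(cone_quot nu) x by rewrite reprK.
move=> /eqmodP /asboolP; rewrite /in_littleo distE => /infinitesimalE hx.
have : \pi_(cone_quot nu) (repr (\val b)) = \pi_(cone_quot nu) y by rewrite reprK.
move=> /eqmodP /asboolP; rewrite /in_littleo distE => /infinitesimalE hy.
apply/star_sub_stE => e e0; have e30 : 0 < e / 3 by rewrite divr_gt0.
have := cone_near a b e30; move: (hx _ e30) (hy _ e30).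
set a' := repr (\val a); set b' := repr (\val b) => ha hb hab.
apply: filterS3 (filterI ha hb) hab (filterI
  (filterI (d_triangle x a' y) (d_triangle a' b' y))
  (filterI (d_triangle a' x b') (d_triangle x y b'))).
move=> n /= [h1 h2] h3 [[h4 h5] [h6 h7]].
have e3 : e = e / 3 + e / 3 + e / 3 by field.
move: h4 h7 h1 h2 h3; rewrite (dC x a') (dC y b') !ltr_norml.
by move=> h4 h7 /andP[? ?] /andP[? ?] /andP[? ?]; apply/andP; split; lra.
Qed.

Lemma cone_distxx (a : C) : cone_dist a a = 0.
Proof.
rewrite /cone_dist distE; apply: st_unique; apply/star_sub_stE => e e0.
by apply: filterS filterT => n _ /=; rewrite /d mdistxx mul0r subr0 normr0.
Qed.

Lemma cone_dist_eq0 (a b : C) : cone_dist a b = 0 -> a = b.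
Proof.
move=> ab0; apply: val_inj; rewrite -[LHS]reprK -[RHS]reprK.
apply/eqmodP/asboolP; rewrite /in_littleo distE.
apply/infinitesimalE => e /(cone_near a b).
by rewrite ab0; apply: filterS => n /=; rewrite subr0.
Qed.

Lemma cone_dist_sym (a b : C) : cone_dist a b = cone_dist b a.
Proof. by rewrite /cone_dist star_distC. Qed.

Lemma cone_dist_triangle (b a c : C) :
  cone_dist a c <= cone_dist a b + cone_dist b c.
Proof.
apply/ler_addgt0Pl => e e0; have e30 : 0 < e / 3 by rewrite divr_gt0.
have [n /= [[h1 h2] [h3 h4]]] := filter_ex (filterI
  (filterI (cone_near a c e30) (cone_near a b e30)) (filterI (cone_near b c e30)
  (d_triangle (repr (\val a)) (repr (\val b)) (repr (\val c))))).
have e3 : e = e / 3 + e / 3 + e / 3 by field.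
move: h1 h2 h3; rewrite !ltr_norml => /andP[? ?] /andP[? ?] /andP[? ?]; lra.
Qed.

HB.instance Definition _ := isMetric.Build R C
  cone_distxx cone_dist_eq0 cone_dist_sym cone_dist_triangle.

End ConeMetric.

End Cone.

End Ultrapower.

Section Isometry.
Variables (R : realType) (X Z : metricType R).

Definition isometric : Prop :=
  exists2 f : X -> Z, bijective f & forall x y, mdist (f x) (f y) = mdist x y.

End Isometry.

Definition is_asymptotic_cone (U : nonprincipal_ultrafilter) (R : realType)
    (X : metricType R) : Prop :=
  exists (Y : metricType R) (q : star U Y) (nu : star U R)
    (nu1 : much_greater nu (star_of U 1)), isometric X (cone q nu1).

Section RealTree.
Variables (R : realType) (X : metricType R).
Implicit Types (x y z p : X) (l : R) (g : R -> X).

(* A map [[0, l] -> X] is represented by a total function [R -> X] of which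
   only the values on [[0, l]] matter. *)
Definition geodesic l g : Prop :=
  0 <= l /\ {in `[0, l] &, forall s t : R, mdist (g t) (g s) = `|t - s|}.

Definition joins x y l g : Prop := [/\ geodesic l g, g 0 = x & g l = y].

Definition geodesic_space : Prop := forall x y, exists l g, joins x y l g.

Definition geodesic_segment x y (A : set X) : Prop :=
  exists l g, joins x y l g /\ A = [set g t | t in `[0, l]%classic].

Definition geodesic_triangle (A B C : set X) : Prop :=
  exists x y z, [/\ geodesic_segment x y A, geodesic_segment y z B
                  & geodesic_segment z x C].

Definition tripod (A B C : set X) : Prop :=
  [/\ A `<=` B `|` C, B `<=` A `|` C & C `<=` A `|` B].

(* The completeness axiom of [completeType], which cannot be used as such
   since it also bundles a distinguished point. *)
Definition complete_space : Prop :=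
  forall F : set_system X, ProperFilter F -> cauchy F -> exists x, F --> x.

Definition real_tree : Prop :=
  [/\ complete_space, geodesic_space
    & forall A B C, geodesic_triangle A B C -> tripod A B C].

Definition geodesics_extend : Prop :=
  forall l g, 0 < l -> geodesic l g ->
  exists l' g', [/\ l < l', geodesic l' g' & {in `[0, l], g' =1 g}].

(* The connected components of [X] minus [p], whose cardinality is the valency
   of [X] at [p]. *)
Definition branches p : set (set X) :=
  connected_component (~` [set p]) @` (~` [set p]).

Definition finite_valency p : Prop := finite_set (branches p).

(* Valency greater than 2, i.e. not at most 2. *)
Definition branching_point p : Prop := ~~ (branches p #<= `I_2)%card.

End RealTree.

Arguments geodesic_space {R} X.
Arguments complete_space {R} X.
Arguments real_tree {R} X.
Arguments geodesics_extend {R} X.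

(* Main.v *)
Require Import Defs.
From mathcomp Require Import all_boot all_order all_algebra generic_quotient.
From mathcomp Require Import all_classical all_reals all_analysis.
From mathcomp Require Import lra.

(* Two points are in the same branch at p iff their Gromov product at p is
   positive, so the valency at p bounds the number of points at distance 1 from
   p lying pairwise at distance 2; let k be the largest such number. A branching
   point x near p turns such a configuration of k points into k + 1 points at
   distance 1 from p lying pairwise at distance at least 2 - 2 d(x, p): two
   branches at x avoid p, and at most one of the k points is in the branch of x
   at p. If such x accumulate at p, then saturation of the ultrapower gives, in
   the cone, k + 1 points lying pairwise at distance exactly 2, contradicting
   the choice of k. *)

Set Implicit Arguments.
Unset Strict Implicit.
Unset Printing Implicit Defensive.

Import Order.TTheory GRing.Theory Num.Theory.
Local Open Scope classical_set_scope.
Local Open Scope ring_scope.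
Local Open Scope quotient_scope.

(** * Diagonal choice along a non-principal ultrafilter *)

Section Diagonal.
Variable U : nonprincipal_ultrafilter.

Lemma ultra_setC1 (n : nat) : U (~` [set n]).
Proof.
have [Un|//] := in_ultra_setVsetC [set n] (ultra_setsP U).
case: (@ultra_setsNprincipal U n); apply/seteqP; split => A /=.
  move=> UA; apply/principal_filterP.
  by have [m [Am <-]] := filter_ex (filterI UA Un).
by move=> /principal_filterP An; apply: filterS Un => m ->.
Qed.

Lemma ultra_geq (M : nat) : U [set n | (M <= n)%N].
Proof.
elim: M => [|M IH]; first by apply: filterS filterT.
apply: filterS2 IH (ultra_setC1 M) => n /= Mn /eqP nM.
by rewrite ltn_neqAle eq_sym nM.
Qed.

(* [mu n] is the largest [m <= n] such that [n] is in [A m]. *)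
Lemma ultra_diagonal (A : nat -> set nat) : (forall m, U (A m)) ->
  exists mu : nat -> nat, forall M, U [set n | (M <= mu n)%N /\ A (mu n) n].
Proof.
move=> UA; pose P n : pred 'I_n.+1 := fun m => `[< A m n >].
(* An empty maximum has the default value 0, for which [A] may fail; this does not occur for
   [n >= M] in [A M], and these [n] form a set in [U]. *)
exists (fun n => \max_(m in P n) val m)%N => M.
apply: filterS2 (ultra_geq M) (UA M) => n /= Mn AMn.
pose i : 'I_n.+1 := Ordinal (Mn : (M < n.+1)%N).
have Pi : i \in P n by apply/(@asboolP (A M n)).
split; first exact: (@leq_bigmax_cond _ (mem (P n)) val i Pi).
have /(eq_bigmax_cond val)[j Pj ->] : (0 < #|P n|)%N.
  by apply/card_gt0P; exists i.
by move: Pj => /(@asboolP (A j n)).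
Qed.

End Diagonal.

(** * Saturation of asymptotic cones *)

Section Saturation.
Variables (U : nonprincipal_ultrafilter) (R : realType) (Y : metricType R).
Variables (q : star U Y) (nu : star U R) (nu1 : much_greater nu (star_of U 1)).
Local Notation C := (cone q nu1).

Let D (f g : nat -> Y) (n : nat) : R := mdist (f n) (g n) / repr nu n.

(** The inner [repr] selects a point of [star U Y], the outer one a sequence representing it. *)
Let rep (a : C) : nat -> Y := repr (repr (\val a)).

Let distE (f g : nat -> Y) :
  star_div (star_dist (\pi_(star U Y) f) (\pi_(star U Y) g)) nu =
  \pi_(star U R) (D f g).
Proof. by rewrite -{1}[nu]reprK scaled_distE. Qed.

Let D_triangle f g h : U [set n | D f h n <= D f g n + D g h n].
Proof.
apply: filterS (cone_scale_ge0 nu1) => n /= n0.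
by rewrite -mulrDl ler_wpM2r ?invr_ge0// metric_triangle.
Qed.

Let D_ge0 f g : U [set n | 0 <= D f g n].
Proof.
by apply: filterS (cone_scale_ge0 nu1) => n /= n0; rewrite divr_ge0// mdist_ge0.
Qed.

Let DC f g : D f g = D g f.
Proof. by apply/funext => n; rewrite /D metric_sym. Qed.

Let bounded (f : nat -> Y) := exists M, U [set n | D f (repr q) n <= M].

Let bounded_bigO f :
  bounded f <-> in_bigO (star_dist (\pi_(star U Y) f) q) nu.
Proof.
rewrite -[q in star_dist _ q]reprK /in_bigO distE star_finiteE; split=> -[M UM].
  exists M; apply: filterS2 UM (D_ge0 f (repr q)) => n /= ? ?.
  by rewrite ger0_norm.
by exists M; apply: filterS UM => n /=; apply: le_trans; apply: ler_norm.
Qed.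

Let bounded_rep a : bounded (rep a).
Proof. by apply/bounded_bigO; rewrite reprK; apply: cone_repr. Qed.

Let bounded_near f g M : bounded g -> U [set n | D f g n <= M] -> bounded f.
Proof.
move=> [N UN] UM; exists (M + N).
apply: filterS3 (D_triangle f g (repr q)) UM UN => n /= h1 h2 h3.
by apply: le_trans h1 _; apply: lerD.
Qed.

Let mdist_coneE (a b : C) (f g : nat -> Y) :
    \val a = \pi_(cone_quot Y nu) (\pi_(star U Y) f) ->
    \val b = \pi_(cone_quot Y nu) (\pi_(star U Y) g) ->
  mdist a b = st (\pi_(star U R) (D f g)).
Proof. by move=> af bg; rewrite -distE; apply: cone_distE. Qed.

(** The strict inequality leaves a margin [e - |s - r|], and along [U] the scaled distances are
    within this margin of their standard part [s]. *)
Let cone_dist_lt (a b : C) (r e : R) : `|mdist a b - r| < e ->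
  U [set n | `|D (rep a) (rep b) n - r| < e].
Proof.
rewrite (@mdist_coneE a b (rep a) (rep b)) ?reprK// => abr.
have : star_finite (\pi_(star U R) (D (rep a) (rep b))).
  have [M UM] := bounded_rep a; have [N UN] := bounded_rep b.
  apply/star_finiteE; exists (M + N).
  apply: filterS3 (filterI UM UN) (D_triangle (rep a) (repr q) (rep b))
    (D_ge0 (rep a) (rep b)) => n /= [h1 h2] h3 h4.
  by rewrite ger0_norm// (le_trans h3)// lerD// DC.
move=> /st_finite /star_sub_stE; move: abr; set s := st _ => sr.
have d0 : 0 < e - `|s - r| by rewrite subr_gt0.
move=> /(_ _ d0); apply: filterS => n /= ns.
by rewrite -[D _ _ _](subrK s) -addrA (le_lt_trans (ler_normD _ _))// -ltrBrDr.
Qed.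

(** Configurations [z m] with errors below [1/(m+1)] are glued diagonally: the [n]-th term comes
    from [z (mu n)], where [mu n] exceeds every bound along [U], so all errors become
    infinitesimal. *)
Lemma cone_saturated (I : finType) (p : C) (rho : I -> R) (del : I -> I -> R) :
  (forall e : R, 0 < e -> exists z : I -> C,
    (forall i, `|mdist (z i) p - rho i| < e) /\
    (forall i j, `|mdist (z i) (z j) - del i j| < e)) ->
  exists z : I -> C, (forall i, mdist (z i) p = rho i) /\
    (forall i j, mdist (z i) (z j) = del i j).
Proof.
move=> approx.
have /choice[z zP] (m : nat) : exists z : I -> C,
    (forall i, `|mdist (z i) p - rho i| < m.+1%:R^-1) /\
    (forall i j, `|mdist (z i) (z j) - del i j| < m.+1%:R^-1).
  by apply: approx; rewrite invr_gt0 ltr0n.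
pose A m : set nat := [set n |
  (forall i, `|D (rep (z m i)) (rep p) n - rho i| < m.+1%:R^-1) /\
  (forall i j, `|D (rep (z m i)) (rep (z m j)) n - del i j| < m.+1%:R^-1)].
have [mu muP] : exists mu : nat -> nat,
    forall M, U [set n | (M <= mu n)%N /\ A (mu n) n].
  apply: ultra_diagonal => m; have [zp zz] := zP m.
  (* As [I] is finite, the intersection of these conditions stays in [U]. *)
  apply: filterI; first by apply: filter_forall => i; apply: cone_dist_lt.
  by apply: filter_forall => i; apply: filter_forall => j; apply: cone_dist_lt.
pose w i n := rep (z (mu n) i) n.
have small e : 0 < e ->
    exists M : nat, forall m, (M <= m)%N -> m.+1%:R^-1 < e :> R.
  move=> e0; exists (Num.truncn e^-1) => m Mm.
  rewrite invf_plt ?posrE//.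
  have := truncnS_gt e^-1; move/lt_le_trans; apply.
  by rewrite ler_nat ltnS.
have wp i e : 0 < e -> U [set n | `|D (w i) (rep p) n - rho i| < e].
  move=> /small[M Me]; apply: filterS (muP M) => n /= [/Me me [h _]].
  exact: lt_trans (h i) me.
have ww i j e : 0 < e -> U [set n | `|D (w i) (w j) n - del i j| < e].
  move=> /small[M Me]; apply: filterS (muP M) => n /= [/Me me [_ h]].
  exact: lt_trans (h i j) me.
have wC i : in_cone q (\pi_(cone_quot Y nu) (\pi_(star U Y) (w i))).
  apply/asboolP; exists (\pi_(star U Y) (w i)) => //; apply/bounded_bigO.
  apply: (@bounded_near _ (rep p) (rho i + 1)); first exact: bounded_rep.
  apply: filterS (wp i 1 ltr01) => n /= /ltW /(le_trans (ler_norm _)).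
  by rewrite lerBlDl.
exists (fun i => exist (fun c => in_cone q c) _ (wC i) : C); split=> [i|i j].
  rewrite (@mdist_coneE _ _ (w i) (rep p)) ?reprK//.
  by apply/st_unique/star_sub_stE; apply: wp.
rewrite (@mdist_coneE _ _ (w i) (w j))//.
by apply/st_unique/star_sub_stE; apply: ww.
Qed.

End Saturation.

(** * Geodesics and their concatenation *)

Section Geodesics.
Variables (R : realType) (X : metricType R).
Implicit Types (x y z p : X).

Lemma joins_mdist x y l (g : R -> X) : joins x y l g ->
  [/\ l = mdist x y, {in `[0, l], forall t, mdist x (g t) = t}
    & {in `[0, l], forall t, mdist (g t) y = l - t}].
Proof.
move=> [[l0 gd] <- <-].
have I0 : 0 \in `[0, l] by rewrite in_itv /= lexx.
have Il : l \in `[0, l] by rewrite in_itv /= l0 lexx.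
split=> [|t It|t It].
- by rewrite gd// sub0r normrN ger0_norm.
- by rewrite gd// sub0r normrN ger0_norm//; move: It; rewrite in_itv => /andP[].
- rewrite gd// distrC ger0_norm// subr_ge0.
  by move: It; rewrite in_itv => /andP[].
Qed.

Lemma joins_cat x p y a b (g h : R -> X) : joins x p a g -> joins p y b h ->
  mdist x y = mdist x p + mdist p y ->
  joins x y (a + b) (fun t => if t <= a then g t else h (t - a)).
Proof.
move=> jg jh xpy; have [aE xg gp] := joins_mdist jg.
have [bE ph hy] := joins_mdist jh.
case: jg jh => [[a0 gd] g0 ga] [[b0 hd] h0 hb].
(* The route through [p] gives the upper bound; a smaller distance would give a route from [x] to
   [y] shorter than [a + b]. *)
have mix s t : 0 <= s -> s <= a -> a < t -> t <= a + b ->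
    mdist (g s) (h (t - a)) = t - s.
  move=> s0 sa ta tab.
  have Is : s \in `[0, a] by rewrite in_itv /= s0.
  have It : t - a \in `[0, b] by rewrite in_itv /=; apply/andP; split; lra.
  have := metric_triangle (g s) p (h (t - a)).
  have := metric_triangle x (g s) y.
  have := metric_triangle (g s) (h (t - a)) y.
  rewrite xpy -aE -bE xg// gp// ph// hy// => h1 h2 h3.
  by apply/eqP; rewrite eq_le; apply/andP; split; lra.
split; [split; first exact: addr_ge0| | ].
- move=> s t; rewrite !in_itv /= => /andP[s0 sab] /andP[t0 tab].
  case: (leP t a) => ta; case: (leP s a) => sa.
  + by rewrite gd// in_itv /= ?s0 ?t0.
  + by rewrite mix// distrC ger0_norm// subr_ge0 ltW// (le_lt_trans ta).
  + by rewrite metric_sym mix// ger0_norm// subr_ge0 ltW// (le_lt_trans sa).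
  + rewrite hd; first by congr `|_|; lra.
      by rewrite in_itv /=; apply/andP; split; lra.
    by rewrite in_itv /=; apply/andP; split; lra.
- by rewrite a0.
(* The first branch applies at the endpoint only if [b = 0], and then [y = h 0 = p]. *)
- case: leP => [ab|_]; last by rewrite addrC addKr.
  have b00 : b = 0 by lra.
  by rewrite b00 addr0 ga -h0 -hb b00.
Qed.

Lemma joins_connected x y l (g : R -> X) : joins x y l g ->
  connected [set g t | t in `[0, l]%classic].
Proof.
move=> [[l0 gd] _ _].
apply: connected_continuous_connected; first exact: segment_connected.
apply/subspace_continuousP => t It; apply/cvg_ballP => e e0.
apply/nbhs_ballP; exists e => //= s ts Is.
by rewrite ballEmdist /= gd ?inE.
Qed.

End Geodesics.

(** * Branches at a point and Gromov products *)

Section Branches.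
Variables (R : realType) (X : metricType R).
Implicit Types (x y z p : X).

(* The Gromov product of [x] and [y] at [p] is positive. *)
Definition same_side p x y : Prop := mdist x y < mdist x p + mdist p y.

Lemma same_sideN p x y : ~ same_side p x y -> mdist x y = mdist x p + mdist p y.
Proof.
move=> /negP; rewrite -leNgt => h.
by apply/eqP; rewrite eq_le h metric_triangle.
Qed.

Lemma same_side_sym p x y : same_side p x y -> same_side p y x.
Proof.
by rewrite /same_side (metric_sym y x) (metric_sym y p) (metric_sym p x) addrC.
Qed.

Lemma same_side_neq p x y : same_side p x y -> x <> p.
Proof. by rewrite /same_side => + xp; rewrite xp mdistxx add0r ltxx. Qed.

Lemma same_side_near p x y : mdist x y < mdist x p -> same_side p x y.
Proof. by move=> h; rewrite /same_side (lt_le_trans h)// lerDl mdist_ge0. Qed.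

Hypothesis treeX : real_tree X.

(* Otherwise [p] would be on a side of the triangle [x, y, z] but on neither of
   the other two. *)
Lemma same_side_trans p y x z :
  same_side p x y -> same_side p y z -> same_side p x z.
Proof.
case: treeX => _ geoX triX xy yz.
have [//|/same_sideN xpz] := pselect (same_side p x z).
have [a [g jg]] := geoX x p; have [b [h jh]] := geoX p z.
have [l [u ju]] := geoX z y; have [m [v jv]] := geoX y x.
have jw := joins_cat jg jh xpz; set w := (fun t => _) in jw.
pose seg (l : R) (g : R -> X) := [set g t | t in `[0, l]%classic].
have [|sub _ _] := triX (seg (a + b) w) (seg l u) (seg m v).
  by exists x, z, y; split; do 2!eexists; split; eauto.
have [|[t It up]|[t It vp]] := sub p.
- exists a; last by rewrite /w lexx; case: jg.
  by case: jg jh => -[a0 _] _ _ [[b0 _] _ _]; rewrite /= in_itv /= a0 lerDl.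
- have [lE zu uy] := joins_mdist ju; have := same_side_sym yz.
  by rewrite /same_side -lE -up zu// uy// addrC subrK ltxx.
- have [mE yv vx] := joins_mdist jv; have := same_side_sym xy.
  by rewrite /same_side -mE -vp yv// vx// addrC subrK ltxx.
Qed.

(** The points on the side of [x] form an open set and, by transitivity, so do the remaining points
    other than [p]; a connected set avoiding [p] cannot meet both. *)
Lemma connected_component_same_side p x y : x <> p ->
  connected_component (~` [set p]) x y -> same_side p x y.
Proof.
move=> xp; set K := connected_component _ _ => Ky.
have Kp : K `<=` ~` [set p] by apply: connected_component_sub.
have near_open (S : set X) : S `<=` ~` [set p] ->
    (forall u v, S u -> same_side p u v -> S v) -> open S.
  move=> Sp Scl; rewrite openE => u Su; apply/nbhs_ballP.
  exists (mdist u p); first by rewrite /= mdist_gt0; apply/eqP/Sp.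
  by rewrite ballEmdist => v /= uv; apply: (Scl u) => //; apply: same_side_near.
pose S := [set u | same_side p x u].
have Sp : S `<=` ~` [set p].
  by move=> u /same_side_sym /same_side_neq.
have : K `&` S = K.
  apply: component_connected.
  - exists x; split; first exact: connected_component_refl.
    by apply: same_side_near; rewrite mdistxx mdist_gt0; apply/eqP.
  - exists S => //; apply: near_open => // u v; exact: same_side_trans.
  (* Adding [p] makes [S] closed in [X] and does not change its trace on [K], which avoids [p]. *)
  - exists ([set p] `|` S); last first.
      apply/seteqP; split=> u [Ku Su]; first by split; last right.
      by split=> //; case: Su => // up; case: (Kp u Ku).
    rewrite -openC setCU; apply: near_open => [u []//|u v [up Su] uv].
    split; first by move=> vp; apply: (same_side_neq (same_side_sym uv)).
    by move=> Sv; apply: Su; apply: same_side_trans Sv (same_side_sym uv).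
by move=> KS; move: Ky; rewrite -KS => -[].
Qed.

(** A geodesic from [x] to [y] through [p] would make the Gromov product vanish, so the geodesic is
    a connected set avoiding [p]. *)
Lemma same_side_connected_component p x y : same_side p x y ->
  connected_component (~` [set p]) x y.
Proof.
case: treeX => _ geoX _ xy; have [l [g jg]] := geoX x y.
have [lE xg gy] := joins_mdist jg.
have [[l0 _] g0 gl] := jg.
have gA : [set g t | t in `[0, l]%classic] `<=` ~` [set p].
  move=> _ [t It <-] gtp; move: xy.
  by rewrite /same_side -lE -gtp xg// gy// addrC subrK ltxx.
apply: (connected_component_max _ gA (joins_connected jg)).
- by exists 0 => //=; rewrite in_itv /= lexx.
- by exists l => //=; rewrite in_itv /= l0 lexx.
Qed.

(** Otherwise a greedy choice of points on different sides stops after at most two, whose components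
    are then all the branches. *)
Lemma branching_point3 x : branching_point x ->
  exists a b c, [/\ a <> x, b <> x & c <> x] /\
    [/\ ~ same_side x a b, ~ same_side x a c & ~ same_side x b c].
Proof.
move=> /negP brx; apply: contrapT => no3; apply: brx.
pose cc := connected_component (~` [set x]).
have same a b : same_side x a b -> cc b = cc a.
  by move=> /same_side_connected_component /same_connected_component.
have [xX|/existsNP[a ax]] := pselect (forall a, a = x).
  suff -> : branches x = set0 by exact: card_ge0.
  by apply/seteqP; split=> // C [a aNx _]; case: aNx; apply: xX.
have card2 (S T : set X) : branches x `<=` [set S; T] ->
    (branches x #<= `I_2)%card.
  move=> ST; pose f (V : set X) : nat := if V == S then 0%N else 1%N.
  have finj : {in branches x &, injective f}.
    move=> V W; rewrite !inE /f => /ST[->|->] /ST[->|->]; rewrite ?eqxx//.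
    - by case: eqP => // ->.
    - by case: eqP => // ->.
  rewrite -(card_le_eql (inj_card_eq finj)); apply: subset_card_le.
  by move=> _ [V _ <-]; rewrite /f /=; case: ifP.
have [aX|/existsNP[b /not_implyP[bx ab]]] :=
    pselect (forall b, b <> x -> same_side x a b).
  apply: (card2 (cc a) (cc a)) => _ [c cx <-]; left.
  by apply: same; apply: aX.
apply: (card2 (cc a) (cc b)) => _ [c cx <-].
have [ac|nac] := pselect (same_side x a c); first by left; apply: same.
have [bc|nbc] := pselect (same_side x b c); first by right; apply: same.
by case: no3; exists a, b, c.
Qed.

(** * Extending geodesics to a prescribed length *)

Hypothesis extX : geodesics_extend X.

Lemma extend_beyond x y L : x <> y -> mdist x y < L ->
  exists z, [/\ y <> z, mdist x z = mdist x y + mdist y z & mdist x z <= L].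
Proof.
case: treeX => _ geoX _ xy xyL; have [l [g jg]] := geoX x y.
have [lE _ _] := joins_mdist jg.
have l0 : 0 < l by rewrite lE mdist_gt0; apply/eqP.
case: jg => gd g0 gl; have [l' [g' [ll' gd' gg']]] := extX l0 gd.
have Il : l \in `[0, l] by rewrite in_itv /= lexx ltW.
have I0 : 0 \in `[0, l] by rewrite in_itv /= lexx ltW.
(* Cutting at [L] secures the bound on [mdist x z], while [t > l] keeps the new point beyond [y]. *)
pose t := Num.min l' L.
have lt : l < t by rewrite lt_min ll' lE.
have tl' : t <= l' by rewrite ge_min lexx.
have It : t \in `[0, l'] by rewrite in_itv /= tl' ltW// (lt_trans l0).
have I'0 : 0 \in `[0, l'] by rewrite in_itv /= lexx ltW// (lt_trans l0).
have I'l : l \in `[0, l'] by rewrite in_itv /= !ltW.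
have xt : mdist x (g' t) = t.
  by rewrite -g0 -gg'// gd'.2// sub0r normrN gtr0_norm// (lt_trans l0).
have yt : mdist y (g' t) = t - l.
  by rewrite -gl -gg'// gd'.2// distrC gtr0_norm// subr_gt0.
exists (g' t); split.
- by move=> yE; move: yt; rewrite -yE mdistxx; lra.
- by rewrite xt yt -lE addrC subrK.
- by rewrite xt ge_min lexx orbT.
Qed.

(* Zorn's lemma for the order [btw u v] ([u] lies between [x] and [v]) on the
   points beyond [y] at distance at most [L] from [x]: completeness bounds
   chains, and a maximal point is at distance [L] as geodesics extend. *)
Lemma extend_to x y L : x <> y -> mdist x y <= L ->
  exists z, mdist x z = mdist x y + mdist y z /\ mdist x z = L.
Proof.
move=> xy xyL.
pose btw u v := mdist x v = mdist x u + mdist u v.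
have btw_trans u v w : btw u v -> btw v w -> btw u w.
  rewrite /btw => uv vw; have := metric_triangle u v w.
  have := metric_triangle x u w => h1 h2.
  by apply/eqP; rewrite eq_le; apply/andP; split; lra.
pose S := {w : X | btw y w /\ mdist x w <= L}.
pose leS (u v : S) : bool := `[< btw (sval u) (sval v) >].
have yS : btw y y /\ mdist x y <= L by rewrite /btw mdistxx addr0.
have [u|u v w /asboolP uv /asboolP vw|A totA|m mmax] :=
    @ZL_preorder S (exist _ y yS) leS.
- by apply/asboolP; rewrite /btw mdistxx addr0.
- by apply/asboolP; apply: btw_trans uv vw.
- have [[a0 Aa0]|A0] := pselect (A !=set0); last first.
    by exists (exist _ y yS) => s As; case: A0; exists s.
  pose E := [set mdist x (sval a) | a in A].
  have supE : has_sup E.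
    split; first by exists (mdist x (sval a0)), a0.
    by exists L => _ [a Aa <-]; case: (svalP a).
  (* The tails of the chain generate the filter to which completeness is applied. *)
  pose B (a : S) := [set sval b | b in [set b | A b /\ btw (sval a) (sval b)]].
  pose F : set_system X := filter_from A B.
  have Bself a : A a -> B a (sval a).
    by move=> Aa; exists a => //=; split=> //; rewrite /btw mdistxx addr0.
  have FF : ProperFilter F.
    apply: filter_from_proper; last first.
      by move=> a Aa; exists (sval a); apply: Bself.
    apply: filter_from_filter; first by exists a0.
    move=> a b Aa Ab; have [/asboolP ab|/asboolP ba] := totA a b Aa Ab.
      exists b => // _ [c [Ac bc] <-].
      by split; exists c => //; split => //; apply: btw_trans bc.
    exists a => // _ [c [Ac ac] <-].
    by split; exists c => //; split => //; apply: btw_trans ac.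
  have [z Fz] : exists z, F --> z.
    case: treeX => cX _ _; apply: cX; apply/cauchy_ballP => e e0.
    (* Distances from [x] add up along the chain, so beyond a point whose distance is within [e] of
       the supremum all points are within [e] of each other. *)
    have [_ [a Aa <-] ae] := sup_adherent e0 supE.
    exists (B a, B a) => /=; first by split; exists a.
    move=> [_ _] [/= [b [Ab ab] <-] [c [Ac ac] <-]].
    rewrite ballEmdist /=.
    have leE d : A d -> mdist x (sval d) <= sup E.
      by move=> Ad; apply: ub_le_sup; [case: supE|exists d].
    have := leE _ Ab; have := leE _ Ac.
    have := mdist_ge0 (sval a) (sval b); have := mdist_ge0 (sval a) (sval c).
    move: ab ac; rewrite /btw.
    have [/asboolP|/asboolP] := totA b c Ab Ac; rewrite /btw.
      by move=> *; lra.
    by rewrite (metric_sym (sval c)) => *; lra.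
  have limit a e : A a -> 0 < e ->
      exists b, [/\ A b, btw (sval a) (sval b) & mdist z (sval b) < e].
    move=> Aa e0.
    have Fe : F (ball z e) by apply: Fz; apply: nbhsx_ballx.
    have FB : F (B a) by exists a.
    have [v [zv [b [Ab ab] bv]]] := filter_ex (filterI Fe FB).
    by exists b; split=> //; move: zv; rewrite -bv ballEmdist.
  have btw_z v : (forall e, 0 < e -> exists b, btw v b /\ mdist z b < e) ->
      btw v z.
    move=> vb; apply/eqP; rewrite eq_le metric_triangle /=.
    apply/ler_addgt0Pl => e e0; have e20 : 0 < e / 2 by rewrite divr_gt0.
    have [b [bv zb]] := vb _ e20.
    have := metric_triangle x z b; have := metric_triangle v b z.
    by rewrite (metric_sym b z) => *; move: bv zb; rewrite /btw => *; lra.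
  have zS : btw y z /\ mdist x z <= L.
    split.
      apply: btw_z => e e0; have [b [_ _ zb]] := limit a0 e Aa0 e0.
      by exists (sval b); split => //; case: (svalP b).
    apply/ler_addgt0Pl => e e0; have [b [_ _ zb]] := limit a0 e Aa0 e0.
    have [_ bL] := svalP b; have := metric_triangle x (sval b) z.
    by rewrite (metric_sym (sval b)) => *; lra.
  exists (exist _ z zS) => a Aa; apply/asboolP => /=.
  apply: btw_z => e e0; have [b [_ ab zb]] := limit a e Aa e0.
  by exists (sval b).
- have [ym mL] := svalP m.
  exists (sval m); split => //; apply/eqP; rewrite eq_le mL leNgt.
  apply/negP => mltL.
  have xm : x <> sval m.
    move=> xm; have := ym; rewrite /btw -xm mdistxx => /eqP.
    by rewrite lt_eqF// ltr_wpDr ?mdist_ge0// mdist_gt0; apply/eqP.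
  have [z [mz xz zL]] := extend_beyond xm mltL.
  have zS : btw y z /\ mdist x z <= L by split => //; apply: btw_trans ym xz.
  (* Now each of [z] and [m] lies between [x] and the other, which forces [m = z]. *)
  have /asboolP : leS (exist _ z zS) m by apply: mmax; apply/asboolP.
  have : 0 < mdist (sval m) z by rewrite mdist_gt0; apply/eqP.
  by move: xz; rewrite /btw /= (metric_sym z) => {xy xm mz} *; lra.
Qed.

(** The point is taken on a geodesic from [x] to [y], or on an extension of it past [y] when [r] is
    larger than [mdist x y]. *)
Lemma same_side_at_dist x y r : y <> x -> 0 < r ->
  exists z, same_side x y z /\ mdist x z = r.
Proof.
move=> yx r0; have xy0 : 0 < mdist x y by rewrite mdist_gt0; apply/eqP/nesym.
rewrite /same_side (metric_sym y x).
have [rle|/ltW xyr] := leP r (mdist x y); last first.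
  have [z [xyz xz]] := extend_to (nesym yx) xyr.
  by exists z; split => //; lra.
case: treeX => _ geoX _; have [l [g jg]] := geoX x y.
have [lE xg gy] := joins_mdist jg.
have Ir : r \in `[0, l] by rewrite in_itv /= ltW//= lE.
exists (g r); rewrite (metric_sym y (g r)) gy// xg//; split => //.
by rewrite -lE; lra.
Qed.

End Branches.

(** * Stars of unit arms, one arm per branch *)

Section UnitStars.
Variables (R : realType) (X : metricType R) (p : X).

(** The second condition amounts to pairwise distance 2, the form in which saturation yields it. *)
Definition unit_star (I : Type) (z : I -> X) : Prop :=
  (forall i, mdist (z i) p = 1) /\
  (forall i j, i <> j -> ~ same_side p (z i) (z j)).

Hypothesis treeX : real_tree X.

Lemma unit_star_card (I : finType) (z : I -> X) (N : nat) :
  unit_star z -> (branches p #<= `I_N)%card -> (#|I| <= N)%N.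
Proof.
move=> [zp zz] pN.
have zNp i : z i <> p.
  by move=> zip; move/eqP: (zp i); rewrite zip mdistxx lt_eqF.
pose f (i : 'I_#|I|) := connected_component (~` [set p]) (z (enum_val i)).
rewrite -card_le_II (card_le_eql card_II).
have finj : {in [set: 'I_#|I|] &, injective f}.
  move=> i j _ _ fij; apply: enum_val_inj; apply: contrapT => /zz; apply.
  apply: connected_component_same_side => //.
  by rewrite -/(f i) fij; apply: connected_component_refl; apply: zNp.
rewrite -(card_le_eql (inj_card_eq finj)); apply: card_le_trans pN.
apply: subset_card_le => _ [i _ <-]; exists (z (enum_val i)) => //.
exact: zNp.
Qed.

Hypothesis extX : geodesics_extend X.

(* Two branches at [x] avoid [p]. The arm of the star leaving towards [x], if
   there is one, is replaced by two arms which split only at [x]. *)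
Lemma branching_point_star (I : Type) (z : I -> X) (x : X) :
    unit_star z -> x <> p -> branching_point x -> mdist x p < 1 ->
  exists w : option I -> X, (forall i, mdist (w i) p = 1) /\
    (forall i j, i <> j -> 2 - 2 * mdist x p <= mdist (w i) (w j)).
Proof.
move=> [zp zz] xp /branching_point3-/(_ treeX)[a [b [c [[ax bx cx] [ab ac bc]]]]].
move=> xp1.
have ST u y v w := @same_side_trans _ _ treeX u y v w.
have SS u v w := @same_side_sym _ X u v w.
(* By transitivity at most one of [a], [b], [c] is on the side of [p]. *)
have [a' [b' [ax' bx' [pa pb ab']]]] : exists a' b', [/\ a' <> x, b' <> x &
    [/\ ~ same_side x p a', ~ same_side x p b' & ~ same_side x a' b']].
  have [pa|pa] := pselect (same_side x p a).
    exists b, c; split=> //; split=> //.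
    - by move=> pb; apply: ab; apply: ST pb; apply: SS.
    - by move=> pc; apply: ac; apply: ST pc; apply: SS.
  have [pb|pb] := pselect (same_side x p b); last by exists a, b.
  exists a, c; split=> //; split=> //.
  by move=> pc; apply: bc; apply: ST pc; apply: SS.
have r0 : 0 < 1 - mdist x p by rewrite subr_gt0.
(* Since [x] lies between [p] and [v], going [1 - mdist x p] beyond [x] ends at distance 1 from [p],
   in the branch of [x]. *)
have arm u : u <> x -> ~ same_side x p u -> exists v,
    [/\ same_side x u v, mdist x v = 1 - mdist x p, mdist v p = 1
      & same_side p x v].
  move=> ux pu; have [v [uv xv]] := same_side_at_dist treeX extX ux r0.
  have /same_sideN : ~ same_side x p v.
    by move=> pv; apply: pu; apply: ST pv (SS _ _ _ uv).
  have xp0 : 0 < mdist x p by rewrite mdist_gt0; apply/eqP.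
  rewrite metric_sym (metric_sym p x) => vp.
  by exists v; split=> //; rewrite /same_side ?(metric_sym p v) ?vp ?xv; lra.
have [u [a'u xu up pu]] := arm _ ax' pa.
have [v [b'v xv vp pv]] := arm _ bx' pb.
have uv : mdist u v = 2 - 2 * mdist x p.
  rewrite (@same_sideN _ _ x); last first.
    by move=> uv; apply: ab'; apply: ST a'u (ST _ _ _ _ uv (SS _ _ _ b'v)).
  by rewrite (metric_sym u) xu xv; lra.
have far y y' : mdist y p = 1 -> mdist y' p = 1 -> ~ same_side p y y' ->
    2 - 2 * mdist x p <= mdist y y'.
  move=> yp yp' /same_sideN ->; rewrite (metric_sym p) yp yp'.
  by have := mdist_ge0 x p; lra.
(* At most one [z j] is replaced by [u], since the arms of the star lie in distinct branches; [v] is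
   the additional arm. *)
pose w (i : option I) :=
  if i is Some j then (if pselect (same_side p x (z j)) then u else z j) else v.
have wNone i : 2 - 2 * mdist x p <= mdist (w (Some i)) v.
  rewrite /=; case: pselect => [xi|xi]; first by rewrite uv.
  by apply: far => // iv; apply: xi; apply: ST pv (SS _ _ _ iv).
exists w; split=> [[i|]|[i|] [j|] ij//].
- rewrite /=; case: pselect => xi; [exact: up|exact: zp].
- by [].
- have {}ij : i <> j by move=> e; apply: ij; rewrite e.
  rewrite /=; case: pselect => xi; case: pselect => xj.
  + by case: (zz _ _ ij); apply: ST (SS _ _ _ xi) xj.
  + by apply: far => // uj; apply: xj; apply: ST pu uj.
  + by apply: far => // iu; apply: xi; apply: ST pu (SS _ _ _ iu).
  + by apply: far => //; apply: zz.
- by rewrite (metric_sym (w None)).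
Qed.

End UnitStars.

(** * Transfer of saturation along an isometry, and the maximal star *)

Lemma asymptotic_cone_saturated (U : nonprincipal_ultrafilter) (R : realType)
    (X : metricType R) (I : finType) (p : X)
    (rho : I -> R) (del : I -> I -> R) :
    is_asymptotic_cone U X ->
  (forall e : R, 0 < e -> exists z : I -> X,
    (forall i, `|mdist (z i) p - rho i| < e) /\
    (forall i j, `|mdist (z i) (z j) - del i j| < e)) ->
  exists z : I -> X, (forall i, mdist (z i) p = rho i) /\
    (forall i j, mdist (z i) (z j) = del i j).
Proof.
move=> [Y [q [nu [nu1 [f [g fK gK] fd]]]]] approx.
have [e /approx[z [zp zz]]|z [zp zz]] :=
    @cone_saturated U R Y q nu nu1 I (f p) rho del.
  by exists (f \o z); split=> [i|i j]; rewrite /= fd.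
by exists (g \o z); split=> [i|i j]; rewrite -fd /= !gK.
Qed.

Theorem proposition5p7 (U : nonprincipal_ultrafilter) (R : realType)
    (X : metricType R) (p : X)
    (treeX : real_tree X) (extX : geodesics_extend X)
    (valp : finite_valency p) (coneX : is_asymptotic_cone U X) :
  exists2 e : R, 0 < e &
    ~ exists x : X, [/\ x <> p, branching_point x & mdist x p < e].
Proof.
have [N pN] : exists N, (branches p #<= `I_N)%card.
  by case: valp => N; rewrite card_eq_le => /andP[pN _]; exists N.
pose starb n := `[< exists z : 'I_n -> X, unit_star p z >].
have [k /asboolP[z zstar] kmax] :
    exists2 k, starb k & forall n, starb n -> (n <= k)%N.
  have starb0 : exists n, starb n.
    by exists 0%N; apply/asboolP; exists (fun=> p); split=> -[].
  have starbN n : starb n -> (n <= N)%N.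
    move=> /asboolP[z zs].
    by have := unit_star_card treeX zs pN; rewrite card_ord.
  by case: (ex_maxnP starb0 starbN) => k ? ?; exists k.
apply: contrapT => noe.
have approx d : 0 < d -> exists w : option 'I_k -> X,
    (forall i, `|mdist (w i) p - 1| < d) /\
    (forall i j, `|mdist (w i) (w j) - (if i == j then 0 else 2)| < d).
  (* The enlarged star requires [mdist x p < 1]; the bound [d / 4] keeps the defect [2 * mdist x p]
     below [d / 2]. *)
  move=> d0; pose e := Num.min 1 (d / 4).
  have e0 : 0 < e by rewrite lt_min ltr01 divr_gt0.
  apply: contrapT => now; apply: noe; exists e => // -[x [xp brx]].
  rewrite lt_min => /andP[x1 xd]; apply: now.
  have [w [wp ww]] := branching_point_star treeX extX zstar xp brx x1.
  exists w; split=> [i|i j]; first by rewrite wp subrr normr0.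
  case: eqP => [->|/ww wij]; first by rewrite mdistxx subrr normr0.
  (* The route through [p] bounds the distance by 2 from above. *)
  have := metric_triangle (w i) p (w j); rewrite (metric_sym p) !wp => wij2.
  by rewrite ltr_norml; apply/andP; split; lra.
have [w [wp ww]] := asymptotic_cone_saturated coneX approx.
have wstar : unit_star p w.
  split=> // i j /eqP ij.
  by rewrite /same_side ww (negbTE ij) (metric_sym p) !wp; lra.
suff /kmax : starb k.+1 by rewrite ltnn.
have cardk : #|{: option 'I_k}| = k.+1 by rewrite card_option card_ord.
apply/asboolP; rewrite -cardk; exists (w \o enum_val).
by case: wstar => _ wN; split=> [i|i j ij] //=; apply: wN => /enum_val_inj.
Qed.
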